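(* There is no constant $C$ such that $\kappa(\Omega)\le C\,\kappa(\Omega^* )$ holds for all balanced connected two-dimensional domains $\Omega\subset\mathbb{R}^2$.
   Context: Domains are nonempty bounded open sets. $\Omega$ is balanced if it is invariant under $\mathbf{x}\mapsto-\mathbf{x}$. Let $\widehat{\chi_\Omega}(\boldsymbol{\xi})=\int_\Omega e^{i\boldsymbol{\xi}\cdot\mathbf{x}}\,d\mathbf{x}$, and let $\mathcal{N}(\Omega)=\{\boldsymbol{\xi}\in\mathbb{R}^2:\widehat{\chi_\Omega}(\boldsymbol{\xi})=0\}$. Set $\kappa(\Omega)=\min\{|\boldsymbol{\xi}|:\boldsymbol{\xi}\in\mathcal{N}(\Omega)\}$, with $\kappa(\Omega)=\infty$ if $\mathcal{N}(\Omega)=\emptyset$. $\Omega^*$ is the disk centred at the origin of the same area as $\Omega$. *)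

(* Defs.v *)
From mathcomp Require Import all_boot all_order all_algebra.
From mathcomp Require Import all_classical all_reals all_analysis.
From mathcomp Require Import complex measurable_realfun ring lra.

Set Implicit Arguments.
Unset Strict Implicit.
Unset Printing Implicit Defensive.

Import Order.TTheory GRing.Theory Num.Theory.
Import numFieldNormedType.Exports.
Local Open Scope classical_set_scope.
Local Open Scope ring_scope.
Local Open Scope complex_scope.

Section PlaneDomains.
Variable R : realType.
Implicit Types (Omega D : set (R * R)) (x xi : R * R) (r : R).

Definition lebesgue2 := (@lebesgue_measure R \x @lebesgue_measure R)%E.

Definition dotp xi x : R := xi.1 * x.1 + xi.2 * x.2.

(* The library norm on [R * R] is the sup norm; [enorm] is the Euclidean one. *)
Definition enorm x : R := Num.sqrt (dotp x x).

Definition planar_domain Omega : Prop :=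
  [/\ Omega !=set0, bounded_set Omega & open Omega].

Definition balanced Omega : Prop := -%R @` Omega = Omega.

(* The integral of exp (i xi . x) over Omega; the library only integrates
   real-valued functions, so its real and imaginary parts are integrated
   separately. *)
Definition fourier_indic Omega xi : R[i] :=
  (\int[lebesgue2]_(x in Omega) cos (dotp xi x)) +i*
  (\int[lebesgue2]_(x in Omega) sin (dotp xi x)).

Definition null_variety Omega : set (R * R) :=
  [set xi | fourier_indic Omega xi = 0].

(* The infimum of the empty set is +oo; for a planar domain with nonempty null
   variety the infimum is attained, see [kappa_min] below. *)
Definition kappa Omega : \bar R :=
  ereal_inf [set (enorm xi)%:E | xi in null_variety Omega].

Definition disk r : set (R * R) := [set x | enorm x < r].

Definition equal_area_disk Omega D : Prop :=
  exists r, [/\ 0 < r, D = disk r & lebesgue2 D = lebesgue2 Omega].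

End PlaneDomains.

Section KappaMin.
Variable R : realType.
Implicit Types (Omega : set (R * R)) (x xi : R * R).

Lemma open_measurable2 Omega :
  open Omega -> measurable (Omega : set (measurableTypeR R * measurableTypeR R)).
Proof.
move=> oO.
pose box (q : (rat * rat) * (rat * rat)) : set (measurableTypeR R * measurableTypeR R) :=
  `]ratr q.1.1, ratr q.1.2[ `*` `]ratr q.2.1, ratr q.2.2[.
pose F q := if `[< box q `<=` Omega >] then box q else set0.
have -> : Omega = \bigcup_q F q.
  apply/seteqP; split => [[a b] Oab|x [q _]]; last first.
    by rewrite /F; case: asboolP => [s|_] //; exact: s.
  have /nbhs_ballP[e /= e0 be] : nbhs (a, b) Omega by exact: open_nbhs_nbhs.
  have rat_near (c : R) : exists q : rat * rat,
      ratr q.1 < c < ratr q.2 /\ c - e < ratr q.1 /\ ratr q.2 < c + e.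
    have [|p] := @rat_in_itvoo R (c - e) c; first by lra.
    rewrite in_itv/= => /andP[p1 p2].
    have [|q] := @rat_in_itvoo R c (c + e); first by lra.
    rewrite in_itv/= => /andP[q1 q2].
    by exists (p, q) => /=; rewrite p2 q1.
  have [qa [/andP[a1 a2] [a3 a4]]] := rat_near a.
  have [qb [/andP[b1 b2] [b3 b4]]] := rat_near b.
  exists (qa, qb) => //; rewrite /F; case: asboolP => [_|[]].
    by rewrite /box /=; split => /=; rewrite in_itv/= ?a1 ?a2 ?b1 ?b2.
  move=> [u v] [/=]; rewrite !in_itv/= => /andP[u1 u2] /andP[v1 v2].
  by apply: be; split; rewrite /ball/= ltr_norml; apply/andP; split; lra.
apply: countable_bigcupT_measurable => [|q]; first exact: countableP.
by rewrite /F; case: asboolP => // _; apply: measurableX.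
Qed.

Lemma planar_domain_bound Omega : planar_domain Omega ->
  exists2 M : R, 0 < M & forall x, Omega x -> `|x.1| <= M /\ `|x.2| <= M.
Proof.
move=> [_ [M [_ bM]] _].
exists (`|M| + 1) => [|x Ox]; first by have := normr_ge0 M; lra.
have := bM (`|M| + 1) _ x Ox.
rewrite /= prod_normE ge_max => h; apply/andP; apply: h.
by have := ler_norm M; lra.
Qed.

Lemma planar_domain_fin Omega : planar_domain Omega ->
  (@lebesgue2 R Omega < +oo)%E.
Proof.
move=> dO; have [M M0 bM] := planar_domain_bound dO.
have [_ _ oO] := dO.
pose B : set (measurableTypeR R * measurableTypeR R) := `[- M, M] `*` `[- M, M].
apply: (@le_lt_trans _ _ (@lebesgue2 R B)).
  apply: le_measure; rewrite ?inE.
  - exact: open_measurable2.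
  - exact: measurableX.
  - by move=> x /bM[]; rewrite !ler_norml /B/= => x1 x2; split; rewrite /= in_itv.
by rewrite /lebesgue2 product_measure1E//= lebesgue_measure_itv/=; case: ifP => _;
  rewrite ?mule0 //= -EFinB -EFinM ltry.
Qed.

Lemma measurable_dotp xi :
  measurable_fun [set: (measurableTypeR R * measurableTypeR R)] (@dotp R xi).
Proof.
apply: measurable_funD; apply: measurable_funM; (exact: measurable_cst || exact: measurable_fst || exact: measurable_snd).
Qed.

Lemma lip_cos (a b : R) : `|cos a - cos b| <= `|a - b|.
Proof.
wlog ab : a b / b <= a.
  by move=> h; have [/h//|/ltW/h] := leP b a; rewrite distrC (distrC b).
have [c _ ->] : exists2 c, c \in `[b, a] & cos a - cos b = (fun t => - sin t) c * (a - b).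
  apply: MVT_segment => //.
  by apply: continuous_subspaceT => t; exact: continuous_cos.
by rewrite normrM ler_piMl// normrN; exact: sin_max.
Qed.

Lemma lip_sin (a b : R) : `|sin a - sin b| <= `|a - b|.
Proof.
wlog ab : a b / b <= a.
  by move=> h; have [/h//|/ltW/h] := leP b a; rewrite distrC (distrC b).
have [c _ ->] : exists2 c, c \in `[b, a] & sin a - sin b = cos c * (a - b).
  apply: MVT_segment => //.
  by apply: continuous_subspaceT => t; exact: continuous_sin.
by rewrite normrM ler_piMl//; exact: cos_max.
Qed.

Lemma fourier_part_continuous Omega (f : R -> R) : planar_domain Omega ->
  continuous f -> (forall a, `|f a| <= 1) ->
  (forall a b, `|f a - f b| <= `|a - b|) ->
  continuous (fun xi => \int[@lebesgue2 R]_(x in Omega) f (dotp xi x)).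
Proof.
move=> dO cf f1 lf xi.
have [M M0 bM] := planar_domain_bound dO.
have mO : measurable (Omega : set (measurableTypeR R * measurableTypeR R)) by case: dO => _ _ /open_measurable2.
have fO := planar_domain_fin dO.
have If eta : (@lebesgue2 R).-integrable Omega
    (EFin \o (fun x => f (dotp eta x))).
  apply: measurable_bounded_integrable => //.
    apply: measurable_funTS; apply: measurableT_comp.
      exact: continuous_measurable_fun.
    exact: measurable_dotp.
  by exists 1; split => // a a1 x _ /=; rewrite (le_trans (f1 _))// ltW.
pose A := fine (@lebesgue2 R Omega).
have A0 : 0 <= A by rewrite fine_ge0.
apply/cvgrPdist_le => e e0.
pose d := e / (2 * M * A + 1).
have d0 : 0 < d by rewrite divr_gt0//; have := mulr_ge0 (ltW M0) A0; lra.
near=> eta.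
rewrite -RintegralB; [|exact: mO|exact: If|exact: If].
have Ifd : (@lebesgue2 R).-integrable Omega
    (EFin \o (fun x => f (dotp xi x) - f (dotp eta x))).
  have := (integrableB mO (If xi) (If eta)).
  apply: eq_integrable => // x _.
apply: (le_trans (le_normr_Rintegral mO Ifd)).
have nd : `|xi - eta| < d by near: eta; apply: cvgr_dist_lt => //; exact: cvg_id.
apply: (@le_trans _ _ (\int[@lebesgue2 R]_(x in Omega) (2 * M * d))).
  apply: le_Rintegral => //.
  - exact: (integrable_norm Ifd).
  - apply: measurable_bounded_integrable => //.
    exists (`|2 * M * d|); split => // a a1 x _ /=; exact: ltW.
  - move=> x /bM[x1 x2]; rewrite (le_trans (lf _ _))//.
    rewrite /dotp.
    have -> : xi.1 * x.1 + xi.2 * x.2 - (eta.1 * x.1 + eta.2 * x.2) =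
      (xi - eta).1 * x.1 + (xi - eta).2 * x.2 by rewrite /=; ring.
    move: nd; rewrite prod_normE/= gt_max => /andP[n1 n2].
    rewrite (le_trans (ler_normD _ _))// !normrM.
    have := ler_pM (normr_ge0 _) (normr_ge0 _) (ltW n1) x1.
    have := ler_pM (normr_ge0 _) (normr_ge0 _) (ltW n2) x2.
    by move=> h1 h2; rewrite (le_trans (lerD h2 h1))//; lra.
rewrite Rintegral_cst// -/A.
have MA := mulr_ge0 (ltW M0) A0.
have h : 0 < 2 * M * A + 1 by lra.
rewrite (_ : _ * A = e * (2 * M * A / (2 * M * A + 1))); last first.
  by rewrite /d; field; rewrite gt_eqF.
by rewrite ler_piMr ?(ltW e0)// ler_pdivrMr//; lra.
Unshelve. all: by end_near.
Qed.

Lemma null_variety_closed Omega : planar_domain Omega ->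
  closed (null_variety Omega).
Proof.
move=> dO.
pose g (f : R -> R) xi := \int[@lebesgue2 R]_(x in Omega) f (dotp xi x).
have -> : null_variety Omega = g cos @^-1` [set 0] `&` g sin @^-1` [set 0].
  apply/seteqP; split => xi /=; first by move=> [].
  by rewrite /null_variety /fourier_indic /g /= => -[-> ->].
have c f : continuous f -> closed (f @^-1` [set (0 : R)] : set (R * R)).
  by move=> cf; apply: closed_comp => // x _; exact: cf.
apply: closedI; apply: c.
- apply: fourier_part_continuous => //; last exact: lip_cos.
    by move=> ?; exact: continuous_cos.
  exact: cos_max.
- apply: fourier_part_continuous => //; last exact: lip_sin.
    by move=> ?; exact: continuous_sin.
  exact: sin_max.
Qed.

Lemma enorm_continuous : continuous (@enorm R).
Proof.
move=> x; apply: (@continuous_comp _ _ _ (fun x => dotp x x) Num.sqrt).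
  by apply: cvgD; apply: cvgM; (exact: cvg_fst || exact: cvg_snd).
exact: sqrt_continuous.
Qed.

Lemma enorm_ge x : `|x.1| <= enorm x /\ `|x.2| <= enorm x.
Proof.
by rewrite -!sqrtr_sqr /enorm /dotp; split; apply: ler_wsqrtr;
  rewrite -!expr2 ?lerDl ?lerDr sqr_ge0.
Qed.

Lemma kappa_min Omega :
  planar_domain Omega -> null_variety Omega !=set0 ->
  exists2 xi, null_variety Omega xi & kappa Omega = (enorm xi)%:E.
Proof.
move=> dO [eta Neta].
pose r := enorm eta.
pose K : set (R * R) := (`[- r, r] `*` `[- r, r]) `&` null_variety Omega.
have inK xi : null_variety Omega xi -> enorm xi <= r -> K xi.
  move=> Nxi xir; have [h1 h2] := enorm_ge xi.
  by split => //; split; rewrite /= in_itv/= -ler_norml (le_trans _ xir).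
have cK : compact K.
  apply: compact_closedI; last exact: null_variety_closed.
  by apply: compact_setX; exact: segment_compact.
have [||xi xiK xi_min] := @compact_EVT_min _ R (@enorm R) K _ cK.
- by exists eta; exact: inK.
- by apply: continuous_subspaceT => x; exact: enorm_continuous.
move: xiK; rewrite inE => -[_ Nxi]; exists xi => //.
apply/eqP; rewrite eq_le; apply/andP; split.
  by apply: ereal_inf_lbound; exists xi.
apply: le_ereal_inf_tmp => _ [zeta Nz <-]; rewrite lee_fin.
have [zr|/ltW rz] := leP (enorm zeta) r.
  by apply: xi_min; rewrite inE; exact: inK.
by apply: le_trans rz; apply: xi_min; rewrite inE; exact: inK.
Qed.
End KappaMin.

(* Main.v *)
(* The counterexamples are the cusped domains
     |y| < b (1 - |x| / a)^2,  |x| < a,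
   with [a] chosen so that the area is that of the unit disk, and [b -> 0].
   Integrating over [y], the Fourier transform at [xi] is
     4 int_0^a cos (xi_1 x) G(x) dx,
   G(x) = sin (xi_2 b (1 - x / a)^2) / xi_2  (G(x) = b (1 - x / a)^2 if xi_2 = 0).
   As long as |xi_2| b <= 1/4, [G] is strictly convex on [0, a] with
   G(a) = G'(a) = 0, so two integrations by parts show that this is positive
   for every xi_1. Hence kappa >= 1 / (4 b), whereas kappa of the unit disk is
   finite: the same formula with the concave profile sqrt (1 - x^2) gives a
   nonpositive transform at (2 pi, 0), and the intermediate value theorem
   yields a zero. *)
Require Import Defs.
From mathcomp Require Import all_boot all_order all_algebra.
From mathcomp Require Import all_classical all_reals all_analysis.
From mathcomp Require Import complex measurable_realfun ring lra.

Set Implicit Arguments.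
Unset Strict Implicit.
Unset Printing Implicit Defensive.

Import Order.TTheory GRing.Theory Num.Theory.
Import numFieldNormedType.Exports.
Local Open Scope classical_set_scope.
Local Open Scope ring_scope.

(** * Integrals over compact intervals: primitives and symmetry *)

Section IntervalIntegrals.
Context {R : realType}.
Local Notation mu := (@lebesgue_measure R).
Implicit Types (f F : R -> R) (a b c t x y : R).

Lemma is_derive_continuous F f :
  (forall x, is_derive x 1 F (f x)) -> continuous F.
Proof.
move=> dF x; apply: differentiable_continuous; apply/derivable1_diffP.
by have [] := dF x.
Qed.

Lemma continuous_integrable_itv f a b :
  continuous f -> mu.-integrable `[a, b] (EFin \o f).
Proof.
move=> cf; apply: continuous_compact_integrable; first exact: segment_compact.
exact: continuous_subspaceT.
Qed.

Lemma integral_derive F f a b : a <= b ->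
  (forall x, is_derive x 1 F (f x)) -> continuous f ->
  (\int[mu]_(x in `[a, b]) (f x)%:E = (F b - F a)%:E)%E.
Proof.
move=> ab dF cf; move: ab; rewrite le_eqVlt => /predU1P[<-|ab].
  by rewrite set_itv1 integral_set1 subrr.
have cF := is_derive_continuous dF.
rewrite (@continuous_FTC2 _ f F)//.
- exact: continuous_subspaceT.
- split => [x _||]; first by have [] := dF x.
  + exact: cvg_at_right_filter (cF a).
  + exact: cvg_at_left_filter (cF b).
- by move=> x _; rewrite derive1E; have [] := dF x.
Qed.

Lemma Rintegral_derive F f a b : a <= b ->
  (forall x, is_derive x 1 F (f x)) -> continuous f ->
  \int[mu]_(x in `[a, b]) f x = F b - F a.
Proof. by move=> ab dF cf; rewrite /Rintegral (integral_derive ab dF). Qed.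

Lemma Rintegral_oppr f a b : a <= b -> continuous f ->
  \int[mu]_(x in `[- b, - a]) f x = \int[mu]_(x in `[a, b]) f (- x).
Proof.
move=> ab cf; rewrite /Rintegral integration_by_substitution_oppr//.
exact: continuous_subspaceT.
Qed.

Lemma Rintegral_symitv f a : 0 <= a -> continuous f ->
  \int[mu]_(x in `[- a, a]) f x = \int[mu]_(x in `[0, a]) (f (- x) + f x).
Proof.
move=> a0 cf; have cfN : continuous (fun x => f (- x)).
  by move=> x; apply: continuous_comp; [exact: opp_continuous|exact: cf].
have i0 := continuous_integrable_itv.
rewrite RintegralD; [|exact: measurable_itv|exact: i0|exact: i0].
rewrite -(Rintegral_oppr a0 cf) oppr0.
(* The interval is split at 0 with the point 0 in the left piece, so the right piece becomes
   half-open; a point has measure zero. *)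
rewrite -[X in _ + X]Rintegral_itv_obnd_cbnd; last first.
  by apply: integrableS (i0 _ 0 a cf) => //; exact: subset_itv_oc_cc.
rewrite -(@Rintegral_itvB _ f (BLeft (- a)) (BRight a) 0 (i0 _ _ _ cf)); last 2 first.
  by rewrite bnd_simp; lra.
  by rewrite bnd_simp.
by rewrite addrC subrK.
Qed.

Lemma Rintegral_sym_odd f a : 0 <= a -> continuous f ->
  (forall x, f (- x) = - f x) -> \int[mu]_(x in `[- a, a]) f x = 0.
Proof.
move=> a0 cf fN; rewrite Rintegral_symitv//.
under eq_Rintegral do rewrite fN addNr.
by rewrite Rintegral_cst// mul0r.
Qed.

Lemma Rintegral_sym_even f a : 0 <= a -> continuous f ->
  (forall x, f (- x) = f x) ->
  \int[mu]_(x in `[- a, a]) f x = 2 * \int[mu]_(x in `[0, a]) f x.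
Proof.
move=> a0 cf fN; rewrite Rintegral_symitv//.
under eq_Rintegral do rewrite fN -mulr2n -mulr_natl.
by rewrite RintegralZl//; exact: continuous_integrable_itv.
Qed.

End IntervalIntegrals.

(** * Iterated primitives of the cosine and positivity for convex profiles *)

Section SinePrimitives.
Context {R : realType}.
Local Notation mu := (@lebesgue_measure R).
Implicit Types (a c t x : R).

(* [sin1 t], [sin2 t] and [sin3 t] are the successive primitives of
   [fun x => cos (t * x)] that vanish at [0]. *)
Definition sin1 t x : R := if t == 0 then x else sin (t * x) / t.
Definition sin2 t x : R :=
  if t == 0 then x ^+ 2 / 2 else (1 - cos (t * x)) / t ^+ 2.
Definition sin3 t x : R :=
  if t == 0 then x ^+ 3 / 6 else (x - sin (t * x) / t) / t ^+ 2.

Lemma is_derive_sin1 t x : is_derive x 1 (sin1 t) (cos (t * x)).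
Proof.
rewrite /sin1; have [->|t0] := eqVneq t 0.
  by rewrite mul0r cos0; exact: is_derive_id.
apply: is_derive_eq; rewrite scaler0 add0r /GRing.scale/=; field.
exact: t0.
Qed.

Lemma is_derive_sin2 t x : is_derive x 1 (sin2 t) (sin1 t x).
Proof.
rewrite /sin1 /sin2; have [_|t0] := eqVneq t 0.
  by apply: is_derive_eq; rewrite /GRing.scale/=; field.
by apply: is_derive_eq; rewrite /GRing.scale/=; field.
Qed.

Lemma is_derive_sin3 t x : is_derive x 1 (sin3 t) (sin2 t x).
Proof.
rewrite /sin2 /sin3; have [_|t0] := eqVneq t 0.
  by apply: is_derive_eq; rewrite /GRing.scale/=; field.
by apply: is_derive_eq; rewrite /GRing.scale/=; field.
Qed.

Lemma continuous_sin1 t : continuous (sin1 t).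
Proof. exact: is_derive_continuous (is_derive_sin1 t). Qed.

Lemma continuous_sin2 t : continuous (sin2 t).
Proof. exact: is_derive_continuous (is_derive_sin2 t). Qed.

Lemma sin1_0 t : sin1 t 0 = 0.
Proof. by rewrite /sin1 mulr0 sin0 mul0r if_same. Qed.

Lemma sin2_0 t : sin2 t 0 = 0.
Proof. by rewrite /sin2 mulr0 cos0 subrr expr0n/= !mul0r if_same. Qed.

Lemma sin3_0 t : sin3 t 0 = 0.
Proof. by rewrite /sin3 mulr0 sin0 expr0n/= !(mul0r, subrr) if_same. Qed.

Lemma sin1N t x : sin1 t (- x) = - sin1 t x.
Proof. by rewrite /sin1 mulrN sinN mulNr; case: ifP. Qed.

Lemma sin2N t x : sin2 t (- x) = sin2 t x.
Proof. by rewrite /sin2 mulrN cosN sqrrN. Qed.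

Lemma sin2_ge0 t x : 0 <= sin2 t x.
Proof.
by rewrite /sin2; case: ifP => _; rewrite divr_ge0 ?sqr_ge0// subr_ge0 cos_le1.
Qed.

Lemma normr_sin_le x : `|sin x| <= `|x|.
Proof. by have := lip_sin x 0; rewrite sin0 !subr0. Qed.

(* Equality in [|sin x| = 2 |sin (x / 2)| |cos (x / 2)| <= |x| |cos (x / 2)|]
   would force [|cos (x / 2)| = 1], hence [sin x = 0]. *)
Lemma normr_sin_lt x : x != 0 -> `|sin x| < `|x|.
Proof.
move=> x0; have nx : 0 < `|x| by rewrite normr_gt0.
have E : sin x = 2 * (sin (x / 2) * cos (x / 2)).
  rewrite {1}(_ : x = (x / 2) *+ 2); last by rewrite -mulr_natr; field.
  by rewrite sin_mulr2n -mulr_natl; ring.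
have [c1|c1] := eqVneq `|cos (x / 2)| 1.
  by rewrite E (cos1sin0 c1) mul0r mulr0 normr0.
have cl : `|cos (x / 2)| < 1 by rewrite lt_neqAle c1 cos_max.
have sl := normr_sin_le (x / 2).
have n2 : `|x / 2| = `|x| / 2 by rewrite normrM (ger0_norm (x := 2^-1)).
rewrite n2 in sl; rewrite E !normrM (ger0_norm (x := 2))//.
have : `|sin (x / 2)| * `|cos (x / 2)| <= `|x| / 2 * `|cos (x / 2)|.
  exact: ler_wpM2r.
have : `|x| / 2 * `|cos (x / 2)| < `|x| / 2 * 1 by rewrite ltr_pM2l//; lra.
by lra.
Qed.

(** For [t != 0] this amounts to [|sin (t * x)| < |t * x|]. It makes the integral of [sin2 t] over
    [0, x] positive at every frequency. *)
Lemma sin3_gt0 t x : 0 < x -> 0 < sin3 t x.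
Proof.
move=> x0; rewrite /sin3; have [t0|t0] := eqVneq t 0.
  by rewrite divr_gt0 ?exprn_gt0.
rewrite divr_gt0//; last by rewrite exprn_even_gt0.
rewrite subr_gt0 (le_lt_trans (ler_norm _))// normrM normfV.
rewrite ltr_pdivrMr ?normr_gt0// -{2}(gtr0_norm x0) -normrM mulrC.
by apply: normr_sin_lt; rewrite mulf_neq0// gt_eqF.
Qed.

Lemma continuous_cosZ t : continuous (fun x : R => cos (t * x)).
Proof.
move=> x; apply: continuous_comp; last exact: continuous_cos.
exact: mulrl_continuous.
Qed.

(* [G * sin1 t - G1 * sin2 t] is a primitive of [G * cos - G2 * sin2 t] that
   vanishes at both ends, so the integral equals that of [G2 * sin2 t]. *)
Lemma cos_integral_convex_gt0 (G G1 G2 : R -> R) a c t : 0 < a -> 0 < c ->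
  (forall x, is_derive x 1 G (G1 x)) -> (forall x, is_derive x 1 G1 (G2 x)) ->
  continuous G2 -> G a = 0 -> G1 a = 0 ->
  (forall x, 0 <= x <= a -> c <= G2 x) ->
  0 < \int[mu]_(x in `[0, a]) (cos (t * x) * G x).
Proof.
move=> a0 c0 dG dG1 cG2 Ga G1a G2c.
have cG := is_derive_continuous dG.
have cfst : continuous (fun x => cos (t * x) * G x).
  by move=> x; apply: cvgM; [exact: continuous_cosZ|exact: cG].
have csnd : continuous (fun x => G2 x * sin2 t x).
  by move=> x; apply: cvgM; [exact: cG2|exact: continuous_sin2].
have := @Rintegral_derive _ (fun x => G x * sin1 t x - G1 x * sin2 t x)
  (fun x => cos (t * x) * G x - G2 x * sin2 t x) 0 a (ltW a0).
rewrite Ga G1a sin1_0 sin2_0 !(mul0r, mulr0, subr0) => /(_ _ _)/wrap[].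
  move=> x; have ? := dG x; have ? := dG1 x.
  have ? := is_derive_sin1 t x; have ? := is_derive_sin2 t x.
  by apply: is_derive_eq; rewrite /GRing.scale/=; ring.
  by move=> x; apply: cvgB; [exact: cfst|exact: csnd].
have ii := continuous_integrable_itv.
rewrite RintegralB; [|exact: measurable_itv|exact: ii|exact: ii].
move=> /subr0_eq ->.
(* Since [sin2 t] is nonnegative, replacing [G2] by its lower bound [c] leaves [c * sin3 t a], which
   is positive. *)
apply: (@lt_le_trans _ _ (\int[mu]_(x in `[0, a]) (c * sin2 t x))).
  rewrite RintegralZl//; last exact/ii/continuous_sin2.
  rewrite (Rintegral_derive (ltW a0) (is_derive_sin3 t) (@continuous_sin2 t)).
  by rewrite sin3_0 subr0 mulr_gt0// sin3_gt0.
apply: le_Rintegral; [exact: measurable_itv| |exact: ii|].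
  apply: ii => x; apply: cvgM; [exact: cvg_cst|exact: continuous_sin2].
move=> x /=; rewrite in_itv/= => /G2c h.
by rewrite ler_wpM2r// sin2_ge0.
Qed.

End SinePrimitives.

(** * Regions between the graphs of [- w] and [w] *)

Section Regions.
Context {R : realType}.
Local Notation mu := (@lebesgue_measure R).
Local Notation R2 := (measurableTypeR R * measurableTypeR R)%type.
Implicit Types (w : R -> R) (f : R * R -> R) (a t : R) (xi p : R * R).

(** The slice over [x] is empty wherever [w x <= 0], so a profile vanishing outside [-a, a] encodes
    its own base interval. *)
Definition region w : set (R * R) := [set p | `|p.2| < w p.1].

Lemma open_region w : continuous w -> open (region w).
Proof.
move=> cw; rewrite (_ : region w = (fun p => w p.1 - `|p.2|) @^-1` [set x | 0 < x]).
  apply: open_comp; last exact: open_gt.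
  move=> p _; apply: cvgB.
    by apply: continuous_comp; [exact: cvg_fst|exact: cw].
  by apply: cvg_norm; exact: cvg_snd.
by apply/seteqP; split => p; rewrite /region/= subr_gt0.
Qed.

Lemma balanced_region w : (forall x, w (- x) = w x) -> balanced (region w).
Proof.
move=> wN; apply/seteqP; split => [_ [p rp <-]|p rp].
  by move: rp; rewrite /region/= wN normrN.
exists (- p); last by rewrite opprK.
by move: rp; rewrite /region/= wN normrN.
Qed.

(** Fubini for [f] extended by zero: the slice over [x] is the open interval from [- w x] to [w x],
    and the vanishing of [F] beyond [a] cuts the outer integral down to [-a, a]. *)
Lemma Rintegral_region w f (F : R -> R) a : continuous w ->
  (@lebesgue2 R).-integrable (region w : set R2) (EFin \o f) ->
  (forall x, \int[mu]_(y in `](- w x)%R, (w x)%R[) (f (x, y))%:E = (F x)%:E)%E ->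
  (forall x, a < `|x| -> F x = 0) ->
  \int[@lebesgue2 R]_(p in region w) f p = \int[mu]_(x in `[- a, a]) F x.
Proof.
move=> cw fint fF F0.
have mr : measurable (region w : set R2).
  apply: open_measurable2; exact: open_region.
rewrite Rintegral_mkcond [in RHS]Rintegral_mkcond /Rintegral; congr fine.
have h : (@lebesgue2 R).-integrable [set: R2] (EFin \o (f \_ (region w))).
  by rewrite -restrict_EFin; apply/(integrable_mkcond _ mr).1.
rewrite -(integral12_prod_meas1 h); apply: eq_integral => x _.
transitivity (F x)%:E; last first.
  rewrite patchE; case: ifPn => //; rewrite notin_setE/= in_itv/= -ler_norml => /negP.
  by rewrite -ltNge => /F0 ->.
rewrite -fF [in RHS]integral_mkcond; apply: eq_integral => y _ /=.
have xy : ((x, y) \in region w) = (y \in [set` `](- w x), (w x)[]).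
  by apply/idP/idP; rewrite !inE /= in_itv/= -ltr_norml.
by rewrite !patchE xy; case: ifP.
Qed.

End Regions.

(** * Fourier transform and area of a region *)

Section FourierRegion.
Context {R : realType}.
Local Notation mu := (@lebesgue_measure R).
Local Notation R2 := (measurableTypeR R * measurableTypeR R)%type.
Implicit Types (w : R -> R) (a t v x y : R) (xi : R * R).

Lemma planar_domain_region w a M : continuous w -> 0 < w 0 ->
  (forall x, w x <= M) -> (forall x, a < `|x| -> w x = 0) ->
  planar_domain (region w).
Proof.
move=> cw w0 wM wa; split.
- by exists (0, 0); rewrite /region/= normr0.
- exists (Num.max a M); split=> [|r ar p rp]; first exact: num_real.
  move: ar; rewrite gt_max => /andP[ar Mr].
  rewrite /= prod_normE/= ge_max; apply/andP; split.
    rewrite leNgt; apply/negP => rp1.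
    by move: rp; rewrite /region/= wa ?normr_lt0// (lt_trans ar).
  by apply: ltW; apply: lt_trans Mr; apply: lt_le_trans (wM p.1).
- exact: open_region.
Qed.

Lemma integrable_dotp (Omega : set (R * R)) (g : R -> R) xi :
  planar_domain Omega -> continuous g -> (forall x, `|g x| <= 1) ->
  (@lebesgue2 R).-integrable (Omega : set R2) (EFin \o (fun p => g (dotp xi p))).
Proof.
move=> dO cg g1; have [_ _ oO] := dO.
apply: measurable_bounded_integrable.
- exact: open_measurable2.
- exact: planar_domain_fin.
- apply: measurable_funTS; apply: measurableT_comp (measurable_dotp xi).
  exact: continuous_measurable_fun.
- by exists 1; split => // M M1 x _ /=; rewrite (le_trans (g1 _))// ltW.
Qed.

Lemma integral_symitvoo (F f : R -> R) v : 0 <= v ->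
  (forall x, is_derive x 1 F (f x)) -> continuous f ->
  (\int[mu]_(y in `](- v)%R, v[) (f y)%:E = (F v - F (- v))%:E)%E.
Proof.
move=> v0 dF cf; rewrite -(@integral_derive _ F f)//; last by lra.
rewrite integral_itv_bndoo//; apply/measurable_EFinP/measurable_funTS.
exact: continuous_measurable_fun.
Qed.

Lemma continuous_affine v t : continuous (fun x => v + t * x).
Proof. by move=> x; apply: cvgD; [exact: cvg_cst|exact: mulrl_continuous]. Qed.

Variables (w : R -> R) (a : R).
Hypotheses (a0 : 0 <= a) (cw : continuous w) (w_ge0 : forall x, 0 <= w x).
Hypotheses (wa : forall x, a < `|x| -> w x = 0).
Hypothesis dw : planar_domain (region w).

Lemma Rintegral_region_cos xi :
  \int[@lebesgue2 R]_(p in region w) cos (dotp xi p) =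
  \int[mu]_(x in `[- a, a]) (2 * (cos (xi.1 * x) * sin1 xi.2 (w x))).
Proof.
apply: Rintegral_region => //.
- exact: integrable_dotp dw (@continuous_cos R) (@cos_max R).
- move=> x.
  (* The addition formula splits the integrand; [xi.2 * sin2 xi.2 y] is a primitive of
     [sin (xi.2 * y)], also when [xi.2 = 0]. Being even in [y], it cancels over the symmetric slice,
     while the odd [sin1] term doubles. *)
  etransitivity; first apply: (@integral_symitvoo (fun y => cos (xi.1 * x) * sin1 xi.2 y -
     sin (xi.1 * x) * (xi.2 * sin2 xi.2 y))) => //.
  + move=> y; have ? := is_derive_sin1 xi.2 y; have ? := is_derive_sin2 xi.2 y.
    apply: is_derive_eq; rewrite /GRing.scale/= /dotp/= cosD.
    rewrite /sin1; case: eqP => [->|/eqP xi2]; first by rewrite !mul0r sin0; ring.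
    by field.
  + move=> y; apply: continuous_comp; last exact: continuous_cos.
    exact: (@continuous_affine (xi.1 * x) xi.2).
  + by rewrite /= sin1N sin2N; congr EFin; ring.
- by move=> x /wa ->; rewrite sin1_0 !mulr0.
Qed.

Lemma Rintegral_region_sin xi :
  \int[@lebesgue2 R]_(p in region w) sin (dotp xi p) =
  \int[mu]_(x in `[- a, a]) (2 * (sin (xi.1 * x) * sin1 xi.2 (w x))).
Proof.
apply: Rintegral_region => //.
- exact: integrable_dotp dw (@continuous_sin R) (@sin_max R).
- move=> x.
  etransitivity; first apply: (@integral_symitvoo (fun y => sin (xi.1 * x) * sin1 xi.2 y +
     cos (xi.1 * x) * (xi.2 * sin2 xi.2 y))) => //.
  + move=> y; have ? := is_derive_sin1 xi.2 y; have ? := is_derive_sin2 xi.2 y.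
    apply: is_derive_eq; rewrite /GRing.scale/= /dotp/= sinD.
    rewrite /sin1; case: eqP => [->|/eqP xi2]; first by rewrite !mul0r sin0; ring.
    by field.
  + move=> y; apply: continuous_comp; last exact: continuous_sin.
    exact: (@continuous_affine (xi.1 * x) xi.2).
  + by rewrite /= sin1N sin2N; congr EFin; ring.
- by move=> x /wa ->; rewrite sin1_0 !mulr0.
Qed.

Hypothesis wN : forall x, w (- x) = w x.

Let csw xi : continuous (fun x => sin1 xi.2 (w x)).
Proof.
by move=> x; apply: continuous_comp; [exact: cw|exact: continuous_sin1].
Qed.

(** The imaginary part is the integral of a function odd in [x]. In the real part, one factor 2
    comes from the symmetry in [y] and the other from the evenness in [x]. *)
Lemma fourier_region xi : fourier_indic (region w) xi =
  Complex (4 * \int[mu]_(x in `[0, a]) (cos (xi.1 * x) * sin1 xi.2 (w x))) 0.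
Proof.
rewrite /fourier_indic Rintegral_region_cos Rintegral_region_sin; congr Complex.
  have cc : continuous (fun x => cos (xi.1 * x) * sin1 xi.2 (w x)).
    by move=> x; apply: cvgM; [exact: continuous_cosZ|exact: csw].
  have c2 : continuous (fun x => 2 * (cos (xi.1 * x) * sin1 xi.2 (w x))).
    by move=> x; apply: cvgM; [exact: cvg_cst|exact: cc].
  rewrite Rintegral_sym_even//; last by move=> x; rewrite mulrN cosN wN.
  rewrite RintegralZl//; last exact: continuous_integrable_itv.
  by ring.
apply: Rintegral_sym_odd => // [x|x]; last by rewrite mulrN sinN wN; ring.
apply: cvgM; first exact: cvg_cst.
apply: cvgM; last exact: csw.
apply: continuous_comp; [exact: mulrl_continuous|exact: continuous_sin].
Qed.

(** The area is the value of the transform at the origin, where [sin1 0] is the identity. *)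
Lemma lebesgue2_region :
  lebesgue2 (region w) = (4 * \int[mu]_(x in `[0, a]) w x)%:E.
Proof.
have := fourier_region (0, 0); rewrite /fourier_indic => -[h _].
have mr : measurable (region w : set R2).
  by apply: open_measurable2; exact: open_region.
rewrite -[LHS]fineK; last first.
  by rewrite ge0_fin_numE//; exact: planar_domain_fin.
congr EFin; rewrite -[LHS]mul1r -Rintegral_cst//.
transitivity (\int[@lebesgue2 R]_(p in region w) cos (dotp (0, 0) p)).
  by apply: eq_Rintegral => p _; rewrite /dotp/= !mul0r addr0 cos0.
rewrite h; congr (_ * _); apply: eq_Rintegral => x _.
by rewrite /= mul0r cos0 mul1r /sin1 eqxx.
Qed.

End FourierRegion.

(** * The cusped domains and a lower bound for their [kappa] *)

Section Cusp.
Context {R : realType}.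
Local Notation mu := (@lebesgue_measure R).
Implicit Types (x t : R) (xi : R * R).

(** The hypothesis makes the region star-shaped about the origin: it is a union of segments that all
    contain the origin. *)
Lemma connected_region (w : R -> R) :
  (forall x t, 0 <= t <= 1 -> w x <= w (t * x)) -> connected (region w).
Proof.
move=> wt.
pose seg (p : R * R) := (fun t : R => (t * p.1, t * p.2)) @` `[0, 1]%classic.
have -> : region w = \bigcup_(p in region w) seg p.
  apply/seteqP; split => [p rp|_ [p rp [t + <-]]].
    exists p => //; exists 1; first by rewrite /= in_itv/= ler01 lexx.
    by rewrite !mul1r; case: p {rp}.
  rewrite /= in_itv/= => /andP[t0 t1]; rewrite /region/=.
  have := wt p.1 t; rewrite t0 t1 => /(_ isT); apply: lt_le_trans.
  by apply: le_lt_trans rp; rewrite normrM ger0_norm// ler_piMl.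
apply: bigcup_connected => [|p _].
  by exists (0, 0) => p _; exists 0; rewrite ?mul0r//= in_itv/= ler01 lexx.
apply: connected_continuous_connected; first exact: segment_connected.
apply: continuous_subspaceT => t.
exact: (cvg_pair (@mulrr_continuous R p.1 t) (@mulrr_continuous R p.2 t)).
Qed.

Variables (a b : R).
Hypotheses (a0 : 0 < a) (b0 : 0 < b).

(** The truncation by [Num.max 0] extends the profile continuously by 0 outside [-a, a]. *)
Definition cusp x : R := b * Num.max 0 (1 - `|x| / a) ^+ 2.

Lemma cusp_ge0 x : 0 <= cusp x.
Proof. by rewrite mulr_ge0 ?sqr_ge0// ltW. Qed.

Lemma cuspN x : cusp (- x) = cusp x.
Proof. by rewrite /cusp normrN. Qed.

Lemma cusp_out x : a < `|x| -> cusp x = 0.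
Proof.
move=> ax; rewrite /cusp max_l ?expr0n ?mulr0//.
by rewrite subr_le0 ler_pdivlMr// mul1r ltW.
Qed.

Lemma cusp_in x : 0 <= x <= a -> cusp x = b * (1 - x / a) ^+ 2.
Proof.
move=> /andP[x0 xa]; rewrite /cusp ger0_norm// max_r//.
by rewrite subr_ge0 ler_pdivrMr// mul1r.
Qed.

Lemma cusp_le x y : `|y| <= `|x| -> cusp x <= cusp y.
Proof.
move=> yx; rewrite /cusp ler_pM2l//.
have xy : Num.max 0 (1 - `|x| / a) <= Num.max 0 (1 - `|y| / a).
  rewrite ge_max !le_max lexx/= lerD2l lerN2 ler_pM2r ?invr_gt0//.
  by rewrite yx orbT.
by rewrite !expr2 ler_pM// le_max lexx.
Qed.

Lemma continuous_cusp : continuous cusp.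
Proof.
move=> x; apply: cvgM; first exact: cvg_cst.
have cm : {for x, continuous (fun y => Num.max (0 : R) (1 - `|y| / a))}.
  apply: continuous_max; first exact: cvg_cst.
  apply: cvgB; first exact: cvg_cst.
  by apply: cvgM; [exact: norm_continuous|exact: cvg_cst].
exact: (cvgM cm cm).
Qed.

Lemma cusp0 : cusp 0 = b.
Proof. by rewrite /cusp normr0 mul0r subr0 max_r// expr1n mulr1. Qed.

Lemma planar_domain_cusp : planar_domain (region cusp).
Proof.
apply: (@planar_domain_region _ _ a b).
- exact: continuous_cusp.
- by rewrite cusp0.
- by move=> x; rewrite -[leRHS]cusp0 cusp_le// normr0.
- exact: cusp_out.
Qed.

Lemma connected_cusp : connected (region cusp).
Proof.
apply: connected_region => x t /andP[t0 t1].
by apply: cusp_le; rewrite normrM ger0_norm// ler_piMl.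
Qed.

(** The area depends only on [a * b], so [b] can shrink at constant area if [a] grows. *)
Lemma lebesgue2_cusp : lebesgue2 (region cusp) = (4 * (a * b / 3))%:E.
Proof.
rewrite (lebesgue2_region (ltW a0) continuous_cusp cusp_ge0 cusp_out)//;
  [|exact: planar_domain_cusp|exact: cuspN].
congr (_ * _)%:E.
under eq_Rintegral => x do [rewrite inE/= in_itv/= => xa; rewrite (cusp_in xa)].
have an0 : a != 0 by rewrite gt_eqF.
have dF x : is_derive x 1 (fun y => - (a * b / 3) * (1 - y / a) ^+ 3)
    (b * (1 - x / a) ^+ 2).
  by apply: is_derive_eq; rewrite /GRing.scale/=; field.
rewrite (Rintegral_derive (ltW a0) dF) => [|x].
  by rewrite divff// mul0r; ring.
have c1 : {for x, continuous (fun y : R => 1 - y / a)}.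
  by apply: cvgB; [exact: cvg_cst|exact: mulrr_continuous].
by apply: cvgM; [exact: cvg_cst|exact: (cvgM c1 c1)].
Qed.

(* On [0, a] the profile is [v x = b * (1 - x / a) ^+ 2], with
   [v' ^+ 2 = 4 * b / a ^+ 2 * v]; so the second derivative of
   [sin (eta * v) / eta] is [2 * b / a ^+ 2 * (cos u - 2 * u * sin u)] with
   [u = eta * v], positive for small [u]. *)
Lemma fourier_cusp_neq0 xi : `|xi.2| * b <= 4^-1 ->
  ~ null_variety (region cusp) xi.
Proof.
move=> xb; rewrite /null_variety/=.
rewrite (fourier_region (ltW a0) continuous_cusp cusp_ge0 cusp_out)//;
  [|exact: planar_domain_cusp|exact: cuspN].
move=> [] /eqP; rewrite mulf_eq0 pnatr_eq0/= => /eqP h.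
suff : 0 < \int[mu]_(x in `[0, a]) (cos (xi.1 * x) * sin1 xi.2 (cusp x)).
  by rewrite h ltxx.
set eta := xi.2 in xb *.
pose v x := b * (1 - x / a) ^+ 2.
pose v1 x := - (2 * b / a) * (1 - x / a).
pose G2 x := 2 * b / a ^+ 2 * (cos (eta * v x) - 2 * (eta * v x) * sin (eta * v x)).
have an0 : a != 0 by rewrite gt_eqF.
have dv x : is_derive x 1 v (v1 x).
  by apply: is_derive_eq; rewrite /GRing.scale/= /v1; field.
have dv1 x : is_derive x 1 v1 (2 * b / a ^+ 2).
  by apply: is_derive_eq; rewrite /GRing.scale/=; field.
have cv := is_derive_continuous dv.
have cev : continuous (fun x => eta * v x).
  by move=> x; apply: cvgM; [exact: cvg_cst|exact: cv].
under eq_Rintegral => x do [rewrite inE/= in_itv/= => xa; rewrite (cusp_in xa)].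
apply: (@cos_integral_convex_gt0 _ (fun x => sin1 eta (v x))
  (fun x => cos (eta * v x) * v1 x) G2 a (b / a ^+ 2)) => //.
- by rewrite divr_gt0// exprn_gt0.
- by move=> x; exact: (is_derive1_comp (is_derive_sin1 eta (v x)) (dv x)).
- move=> x; apply: is_derive_eq; rewrite /GRing.scale/=.
  by rewrite /G2 /v1 /v; field.
- move=> x; apply: cvgM; first exact: cvg_cst.
  apply: cvgB; first by apply: continuous_comp; [exact: cev|exact: continuous_cos].
  apply: cvgM.
    by apply: cvgM; [exact: cvg_cst|exact: cev].
  by apply: continuous_comp; [exact: cev|exact: continuous_sin].
- by rewrite /v divff// subrr expr0n mulr0 sin1_0.
- by rewrite /v1 divff// subrr !mulr0.
(* It remains to bound [G2] below by [b / a ^+ 2]. From [|u| <= 1/4] follow [cos u >= 3/4] and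
   [|2 * u * sin u| <= 1/8], so the bracket in [G2] is at least 5/8, more than the required 1/2. *)
move=> x /andP[x0 xa].
have y0 : 0 <= x / a by rewrite divr_ge0// ltW.
have y1 : x / a <= 1 by rewrite ler_pdivrMr// mul1r.
have v0 : 0 <= v x by rewrite mulr_ge0 ?sqr_ge0// ltW.
have vb : v x <= b.
  by rewrite ler_piMr ?(ltW b0)// expr_le1//; lra.
have u4 : `|eta * v x| <= 4^-1.
  by rewrite normrM (ger0_norm v0) (le_trans _ xb)// ler_wpM2l.
rewrite /G2; set u := eta * v x in u4 *.
have cu : `|cos u - 1| <= 4^-1.
  by have := lip_cos u 0; rewrite cos0 subr0 => /le_trans; exact.
have su : `|u * sin u| <= 4^-1 * 4^-1.
  by rewrite normrM ler_pM// (le_trans (normr_sin_le u)).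
rewrite (_ : 2 * b / a ^+ 2 * _ =
  b / a ^+ 2 * (2 * (cos u - 2 * (u * sin u)))); last by ring.
rewrite ler_peMr ?divr_ge0 ?sqr_ge0 ?(ltW b0)//.
by move: u4 cu su; rewrite !ler_norml => /andP[? ?] /andP[? ?] /andP[? ?]; lra.
Qed.

(** Every zero has [|xi.2| > 1 / (4 b)], and the Euclidean norm dominates [|xi.2|]. The bound on the
    infimum also covers an empty null variety. *)
Lemma kappa_cusp : ((4 * b)^-1%:E <= kappa (region cusp))%E.
Proof.
apply: le_ereal_inf_tmp => _ [xi Nxi <-]; rewrite lee_fin.
have [_] := enorm_ge xi; apply: le_trans.
rewrite leNgt; apply/negP => h; apply: (@fourier_cusp_neq0 xi) => //.
by rewrite -ler_pdivlMr// (le_trans (ltW h))// invfM.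
Qed.

End Cusp.

(** * The unit disk: finiteness of [kappa] and an upper bound *)

Section UnitDisk.
Context {R : realType}.
Local Notation mu := (@lebesgue_measure R).
Local Notation R2 := (measurableTypeR R * measurableTypeR R)%type.
Implicit Types (x t : R) (xi : R * R).

(** [Num.sqrt] is 0 on negative numbers, so this profile vanishes outside [-1, 1]. *)
Definition arc x : R := Num.sqrt (1 - x ^+ 2).

Lemma arc_out x : 1 < `|x| -> arc x = 0.
Proof.
move=> x1; apply: ler0_sqrtr; rewrite subr_le0 -real_normK ?num_real// expr2.
by have := ltr_pM ler01 ler01 x1 x1; lra.
Qed.

Lemma arc_le1 x : arc x <= 1.
Proof. by rewrite -[leRHS]sqrtr1 ler_wsqrtr// gerBl sqr_ge0. Qed.

Lemma arc0 : arc 0 = 1.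
Proof. by rewrite /arc expr0n subr0 sqrtr1. Qed.

Lemma arcN x : arc (- x) = arc x.
Proof. by rewrite /arc sqrrN. Qed.

Lemma continuous_arc : continuous arc.
Proof.
move=> x; apply: (@continuous_comp _ _ _ (fun y : R => 1 - y ^+ 2) Num.sqrt).
  by apply: cvgB; [exact: cvg_cst|exact: (@exprn_continuous R 2)].
exact: sqrt_continuous.
Qed.

Lemma disk1E : disk 1 = region arc.
Proof.
apply/seteqP; split => p; rewrite /disk /region /arc /= -(sqrtr_sqr p.2).
  rewrite /enorm -[X in _ < X]sqrtr1 ltr_sqrt// /dotp => p1.
  by rewrite ltr_sqrt; have := sqr_ge0 p.2; rewrite !expr2; lra.
have [p1|p1] := leP (1 - p.1 ^+ 2) 0.
  by rewrite (ler0_sqrtr p1) ltNge sqrtr_ge0.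
rewrite ltr_sqrt// => p2; rewrite /enorm -[ltRHS]sqrtr1 ltr_sqrt// /dotp.
by move: p2; rewrite !expr2; lra.
Qed.

Lemma planar_domain_disk1 : planar_domain (@disk R 1).
Proof.
rewrite disk1E; apply: (@planar_domain_region _ _ 1 1).
- exact: continuous_arc.
- by rewrite arc0.
- exact: arc_le1.
- exact: arc_out.
Qed.

(** The disk contains the square of side 1/2 with a corner at the origin. Positive area will make
    the half-width [a] of the cusped domain positive. *)
Lemma lebesgue2_disk1_gt0 : (0 < lebesgue2 (@disk R 1))%E.
Proof.
pose B : set R2 := `[0, 2^-1] `*` `[0, 2^-1].
apply: (@lt_le_trans _ _ (@lebesgue2 R B)).
  rewrite /lebesgue2 product_measure1E//= lebesgue_measure_itv/= lte_fin.
  by rewrite invr_gt0 ltr0n/= -EFinB -EFinM lte_fin; lra.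
apply: le_measure; rewrite ?inE.
- exact: measurableX.
- by apply: open_measurable2; have [] := planar_domain_disk1.
- move=> p [/=]; rewrite !in_itv/= => /andP[? ?] /andP[? ?].
  rewrite /disk/= /enorm -[ltRHS]sqrtr1 ltr_sqrt// /dotp.
  by nra.
Qed.

Let k := 2 * pi : R.

Let k0 : 0 < k. Proof. by rewrite mulr_gt0// pi_gt0. Qed.

(** [0, 1] is one full period of [cos (k * x)], so constants integrate to 0 against it; about the
    midpoint 1/2 the cosine is even and [x - 1/2] is odd. *)
Lemma cos_affine_integral0 (c m : R) :
  \int[mu]_(x in `[0, 1]) (cos (k * x) * (c + m * x)) = 0.
Proof.
have kn0 : k != 0 by rewrite gt_eqF.
have dF x : is_derive x 1
    (fun y => sin (k * y) / k * (c + m * y) + m * (cos (k * y) / k ^+ 2))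
    (cos (k * x) * (c + m * x)).
  by apply: is_derive_eq; rewrite /GRing.scale/=; field.
rewrite (Rintegral_derive ler01 dF) => [|x]; last first.
  by apply: cvgM; [exact: continuous_cosZ|exact: continuous_affine].
have kE : k = pi *+ 2 by rewrite /k mulr_natl.
by rewrite !mulr1 !mulr0 kE cos2pi sin2pi cos0 sin0 -kE; ring.
Qed.

(* The secant of [arc] through [1/4] and [3/4], the zeros of
   [cos (2 * pi * x)] on [0, 1], lies below the concave function [arc] exactly
   where the cosine is negative; and it is orthogonal to the cosine. *)
Lemma cos_arc_integral_le0 :
  \int[mu]_(x in `[0, 1]) (cos (k * x) * arc x) <= 0.
Proof.
pose p : R := arc 4^-1; pose q : R := arc (3 / 4).
have p0 : 0 <= p by exact: sqrtr_ge0.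
have q0 : 0 <= q by exact: sqrtr_ge0.
have p2 : p ^+ 2 = 15 / 16 by rewrite sqr_sqrtr; [field|lra].
have q2 : q ^+ 2 = 7 / 16 by rewrite sqr_sqrtr; [field|lra].
have pq : q <= p by rewrite -ler_sqr ?nnegrE// p2 q2; lra.
have pq3 : p <= 3 * q.
  by rewrite -ler_sqr ?nnegrE// ?mulr_ge0// exprMn p2 q2; lra.
(* Slope and intercept of the secant through [(1/4, p)] and [(3/4, q)]. *)
pose m := 2 * (q - p); pose c := p - m / 4.
pose l x := c + m * x.
rewrite -[leRHS](cos_affine_integral0 c m); apply: le_Rintegral => //.
- apply: continuous_integrable_itv => x.
  by apply: cvgM; [exact: continuous_cosZ|exact: continuous_arc].
- apply: continuous_integrable_itv => x.
  by apply: cvgM; [exact: continuous_cosZ|exact: continuous_affine].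
move=> x /=; rewrite in_itv/= => /andP[x0 x1].
rewrite -/(l x).
have m0 : m <= 0 by rewrite /m; lra.
(* The secant is nonincreasing and its value at 1 is [(3 * q - p) / 2], nonnegative by [pq3]. Its
   sign allows [arc] and [l] to be compared through their squares. *)
have lx0 : 0 <= l x.
  have : 0 <= - m * (1 - x) by rewrite mulr_ge0 ?oppr_ge0// subr_ge0.
  by rewrite /l /c /m; lra.
(* The difference is quadratic in [x], with leading coefficient [- (1 + m ^+ 2)] and roots at the
   two secant points. *)
have E : arc x ^+ 2 - l x ^+ 2 = (1 + m ^+ 2) * ((x - 4^-1) * (3 / 4 - x)).
  rewrite sqr_sqrtr; last by rewrite subr_ge0 expr_le1.
  apply/eqP; rewrite -subr_eq0; apply/eqP.
  transitivity ((2 * (x - 4^-1) - 1) * (p ^+ 2 - 15 / 16) -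
      2 * (x - 4^-1) * (q ^+ 2 - 7 / 16)); first by rewrite /l /c /m; field.
  by rewrite p2 q2; ring.
have m1 : 0 < 1 + m ^+ 2 by rewrite ltr_pwDl// sqr_ge0.
have arc_le : 0 <= (4^-1 - x) * (3 / 4 - x) -> arc x <= l x.
  move=> h; rewrite -ler_sqr ?nnegrE ?sqrtr_ge0// -subr_ge0 -opprB E.
  by rewrite -mulrN mulr_ge0 ?(ltW m1)// -mulNr opprB.
have pi0 := @pi_gt0 R.
have [x4|x4] := leP x 4^-1.
  rewrite ler_wpM2l//; last by apply: arc_le; rewrite mulr_ge0//; lra.
  by apply: cos_ge0_pihalf; apply/andP; split; rewrite /k; nra.
have [x34|x34] := leP x (3 / 4).
  apply: ler_wnM2l.
    have -> : k * x = (k * x - pi) + pi by rewrite subrK.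
    rewrite cosDpi oppr_le0.
    by apply: cos_ge0_pihalf; apply/andP; split; rewrite /k; nra.
  rewrite -ler_sqr ?nnegrE ?sqrtr_ge0// -subr_ge0 E.
  by rewrite mulr_ge0 ?(ltW m1)// mulr_ge0//; lra.
rewrite ler_wpM2l//; last by apply: arc_le; rewrite mulr_le0//; lra.
have -> : k * x = (k * x - pi *+ 2) + pi *+ 2 by rewrite subrK.
rewrite cosD2pi; apply: cos_ge0_pihalf.
by apply/andP; split; rewrite /k -mulr_natl; nra.
Qed.

(** Along the first axis the transform is real and continuous, nonnegative at 0 and nonpositive at
    [k], so it has a zero in [0, k]. A real value of [kappa] turns its product with [C] into a
    product of reals. *)
Lemma kappa_disk1 :
  exists2 r : R, 0 <= r <= k & kappa (@disk R 1) = r%:E.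
Proof.
have dD := planar_domain_disk1.
pose g t := \int[@lebesgue2 R]_(p in disk 1) cos (dotp (t, 0) p).
have E t : fourier_indic (disk 1) (t, 0) = Complex (g t) 0.
  rewrite /g disk1E /fourier_indic; congr Complex.
  have := fourier_region ler01 continuous_arc (fun x => sqrtr_ge0 _) arc_out.
  rewrite -disk1E => /(_ dD arcN (t, 0)).
  by rewrite /fourier_indic => -[].
have cg : continuous g.
  move=> t; apply: (@continuous_comp _ _ _ (fun t : R => (t, 0 : R))
    (fun xi => \int[@lebesgue2 R]_(p in disk 1) cos (dotp xi p))).
    by apply: (@cvg_pair _ _ _ (nbhs t) (nbhs t) (nbhs (0 : R)));
      [exact: cvg_id|exact: cvg_cst].
  apply: fourier_part_continuous => //.
  - exact: continuous_cos.
  - exact: cos_max.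
  - exact: lip_cos.
have g0 : 0 <= g 0.
  apply: Rintegral_ge0 => p _.
  by rewrite /dotp/= !mul0r addr0 cos0.
have gk : g k <= 0.
  have := fourier_region ler01 continuous_arc (fun x => sqrtr_ge0 _) arc_out.
  rewrite -disk1E => /(_ dD arcN (k, 0)).
  rewrite E => -[->]; rewrite pmulr_rle0//.
  under eq_Rintegral do rewrite /sin1 eqxx.
  exact: cos_arc_integral_le0.
have [||t] := @IVT R g 0 k 0 (ltW k0).
- exact: continuous_subspaceT.
- by rewrite ge_min gk orbT le_max g0.
rewrite in_itv/= => /andP[t0 tk] gt0.
have N : null_variety (disk 1) (t, 0) by rewrite /null_variety/= E gt0.
have [xi Nxi kE] := kappa_min dD (ex_intro _ _ N).
exists (enorm xi) => //; rewrite sqrtr_ge0/=.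
have : (kappa (@disk R 1) <= (enorm (t, 0 : R))%:E)%E.
  by apply: ereal_inf_lbound; exists (t, 0).
rewrite kE lee_fin => /le_trans; apply.
by rewrite /enorm /dotp/= mul0r addr0 -expr2 sqrtr_sqr ger0_norm.
Qed.

End UnitDisk.

(** * Refutation of a uniform constant [C] *)

Theorem corollary2p10 (R : realType) :
  ~ exists C : R, forall Omega Omega_star : set (R * R),
      planar_domain Omega -> balanced Omega -> connected Omega ->
      equal_area_disk Omega Omega_star ->
      (kappa Omega <= C%:E * kappa Omega_star)%E.
Proof.
move=> [C hC].
have [r /andP[r0 rk] kE] := @kappa_disk1 R.
have pi0 := @pi_gt0 R.
(* Chosen so that [1 / (4 b) = 2 pi (|C| + 1)], which exceeds [C * r] because [0 <= r <= 2 pi]. *)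
pose b : R := (8 * pi * (`|C| + 1))^-1.
have C1 : 0 < `|C| + 1 by rewrite ltr_wpDl.
have b0 : 0 < b by rewrite invr_gt0 !mulr_gt0.
pose A := fine (lebesgue2 (@disk R 1)).
have AE : lebesgue2 (@disk R 1) = A%:E.
  rewrite fineK// ge0_fin_numE//; exact: planar_domain_fin planar_domain_disk1.
have A0 : 0 < A by rewrite -lte_fin -AE lebesgue2_disk1_gt0.
(* Solves [4 * (a * b / 3) = A], so that the unit disk has the area of the cusped domain. *)
pose a := 3 * A / (4 * b).
have a0 : 0 < a by rewrite divr_gt0// mulr_gt0.
have := hC (region (cusp a b)) (disk 1) (planar_domain_cusp a0 b0)
  (balanced_region (cuspN a b)) (connected_cusp a0 b0).
have eqA : equal_area_disk (region (cusp a b)) (disk 1).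
  exists 1; split => //; rewrite lebesgue2_cusp// AE; congr EFin.
  by rewrite /a; field; rewrite gt_eqF.
move=> /(_ eqA); apply/negP; rewrite -ltNge.
apply: lt_le_trans (kappa_cusp a0 b0).
rewrite kE -EFinM lte_fin.
have -> : (4 * b)^-1 = 2 * pi * (`|C| + 1).
  by rewrite /b invfM invrK; field.
have := ler_norm C; have := normr_ge0 C.
by nra.
Qed.
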